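(* Let $n\ge 7$. The symmetric group $S_n$ satisfies the weak conjecture: for every integer $k\ge 1$ there exists a generating set $A$ of $S_n^k$ with $|A|=\operatorname{rank}(S_n^k)$ and $$\operatorname{diam}(S_n^k,A)\le k\,(|S_n|-\operatorname{rank}(S_n)).$$
   Context: For a finite group $G$ with generating set $A$ and $g\in G$, $l_A(g)$ is the length of a shortest word in the elements of $A$ (no inverses allowed) representing $g$; the identity is represented by the empty word, of length $0$. The diameter is $\operatorname{diam}(G,A)=\max\{l_A(g): g\in G\}$. $\operatorname{rank}(G)$ is the minimum cardinality of a generating set of $G$. $G^k$ is the $k$-th direct power of $G$. *)

(* Defs.v *)
From HB Require Import structures.
From mathcomp Require Import all_boot all_fingroup all_solvable.

Set Implicit Arguments.
Unset Strict Implicit.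
Unset Printing Implicit Defensive.

Local Open Scope group_scope.

Section Diameter.

Variable gT : finGroupType.
Implicit Types (A : {set gT}) (g : gT).

Definition generates A : bool := <<A>> == [set: gT].

(* Only elements of A may occur as letters, not their inverses. *)
Definition has_word A g (m : nat) : bool :=
  [exists w : m.-tuple gT, all [in A] w && (\prod_(x <- w) x == g)].

Lemma has_word_ex A : generates A -> forall g, exists m, has_word A g m.
Proof.
move=> /eqP genA g; have: g \in <<A>> by rewrite genA inE.
case/gen_prodgP=> m [c Ac ->]; exists m.
apply/existsP; exists [tuple c i | i < m]; apply/andP; split.
  by apply/allP=> x /mapP[i _ ->]; apply: Ac.
by rewrite big_tuple; apply/eqP/eq_bigr=> i _; rewrite tnth_mktuple.
Qed.

Definition word_length A (genA : generates A) g : nat :=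
  ex_minn (has_word_ex genA g).

Definition diam A (genA : generates A) : nat :=
  \max_(g : gT) word_length genA g.

End Diameter.

(* 'm(G) is the least cardinality of a generating set of G; beware that the
   library's 'r(G) is a different invariant. *)
Definition group_rank (gT : finGroupType) : nat := 'm([set: gT]).

Definition direct_power (gT : finGroupType) (k : nat) : finGroupType :=
  {dffun forall _ : 'I_k, gT}.

(* The truncated subtraction is harmless: group_rank gT <= #|gT|. *)
Definition weak_conjecture (gT : finGroupType) : Prop :=
  forall k : nat, (0 < k)%N ->
  exists (A : {set direct_power gT k}) (genA : generates A),
    #|A| = group_rank (direct_power gT k)
    /\ (diam genA <= k * (#|gT| - group_rank gT))%N.

(* Main.v *)
Require Import Defs.
From mathcomp Require Import all_boot all_fingroup all_solvable.
From mathcomp Require Import zify.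

(* Let s = (0 1) and let c be a cycle of odd order m: the full n-cycle if n is
   odd, an (n-1)-cycle fixing 0 if n is even.  For k >= 2 take the k elements
   g_i of S_n^k with s at coordinate i, c at coordinate i+1 (mod k) and 1
   elsewhere.  As s has order 2 and m is odd, g_i^m is s at coordinate i and
   g_i^(m+1) is c at coordinate i+1, so the coordinates can be treated one by
   one at a cost of at most m+1 letters for each s or c.  The conjugates of s by
   powers of c are the transpositions of cyclically adjacent points (n odd) or
   those moving 0 (n even), which gives words of length O(n^3) in s and c for
   every permutation; the resulting bound O(n^4) per coordinate is below n! - 2
   from n = 7 on.  The signs of the coordinates map S_n^k onto C_2^k, whence
   rank(S_n^k) >= k.  For k = 1, any generating set A of minimal cardinality
   works, since 1 is not in A, the sphere of radius 1 is A and no sphere up to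
   the diameter is empty. *)

Set Implicit Arguments.
Unset Strict Implicit.
Unset Printing Implicit Defensive.

Local Open Scope group_scope.

(** * Words of bounded length, spheres and the diameter *)

Section Within.

Variable gT : finGroupType.
Implicit Types (A B : {set gT}) (g h x : gT).

(** Length at most [m], where [has_word] asks for length exactly [m]: bounds of this kind can be
    weakened and add up under products. *)
Definition within A m g : Prop :=
  exists w : seq gT, [/\ (size w <= m)%N, all [in A] w & \prod_(x <- w) x = g].

Lemma within_id A m : within A m 1.
Proof. by exists [::]; rewrite big_nil. Qed.

Lemma within_mem A x : x \in A -> within A 1 x.
Proof. by move=> Ax; exists [:: x]; rewrite big_seq1 /= Ax. Qed.

Lemma within_leq A m l g : (m <= l)%N -> within A m g -> within A l g.
Proof. by move=> le_ml [w [szw Aw <-]]; exists w; rewrite (leq_trans szw). Qed.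

Lemma within0 A g : within A 0 g -> g = 1.
Proof. by case=> [[|x w] [//= _ _ <-]]; rewrite big_nil. Qed.

Lemma withinM A m l g h :
  within A m g -> within A l h -> within A (m + l) (g * h).
Proof.
move=> [v [szv Av <-]] [w [szw Aw <-]]; exists (v ++ w).
by rewrite size_cat leq_add // all_cat Av Aw big_cat.
Qed.

Lemma withinX A m g i : within A m g -> within A (i * m) (g ^+ i).
Proof.
move=> Amg; elim: i => [|i IHi]; first exact: within_id.
by rewrite expgS mulSn; apply: withinM.
Qed.

Lemma within_prod A m (I : Type) (r : seq I) (F : I -> gT) :
  (forall i, within A m (F i)) -> within A (size r * m) (\prod_(i <- r) F i).
Proof.
move=> AF; elim: r => [|i r IHr]; first by rewrite big_nil; apply: within_id.
by rewrite big_cons mulSn; apply: withinM.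
Qed.

(** Inverses are not letters, so the inverse of [c ^+ i] is spelled [c ^+ (m - i)]; the total length
    (m - i) + 1 + i does not depend on [i]. *)
Lemma within_conjX A (s c : gT) m i : s \in A -> c \in A -> c ^+ m = 1 ->
  (i <= m)%N -> within A m.+1 (s ^ (c ^+ i)).
Proof.
move=> As Ac cm1 le_im; have cV: (c ^+ i)^-1 = c ^+ (m - i).
  by apply: (mulIg (c ^+ i)); rewrite mulVg -expgD subnK.
rewrite conjgE cV; have Acj j: within A j (c ^+ j).
  by rewrite -[j in within _ j]muln1; apply/withinX/within_mem.
apply: (within_leq (m := (m - i) + (1 + i))); first by lia.
by apply: withinM => //; apply: withinM => //; apply: within_mem.
Qed.

Lemma has_word_within A m g : has_word A g m -> within A m g.
Proof.
by case/existsP=> w /andP[Aw /eqP wg]; exists w; rewrite size_tuple.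
Qed.

Lemma within_has_word A m g :
  within A m g -> exists2 l, (l <= m)%N & has_word A g l.
Proof.
case=> w [szw Aw wg]; exists (size w) => //; apply/existsP.
by exists (in_tuple w); rewrite Aw wg /=.
Qed.

Lemma word_length_leP A (genA : generates A) m g :
  (word_length genA g <= m)%N <-> within A m g.
Proof.
rewrite /word_length; case: ex_minnP => l Al min_l; split=> [le_lm|].
  exact/(within_leq le_lm)/has_word_within.
by case/within_has_word=> j le_jm /min_l le_lj; apply: leq_trans le_jm.
Qed.

Lemma generates_within A m : (forall g, within A m g) -> generates A.
Proof.
move=> Am; rewrite /generates eqEsubset subsetT; apply/subsetP=> g _.
have [w [_ Aw <-]] := Am g; rewrite big_seq.
by apply: group_prod => x /(allP Aw) Ax; apply: mem_gen.
Qed.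

Lemma diam_leP A (genA : generates A) m :
  (forall g, within A m g) -> (diam genA <= m)%N.
Proof. by move=> Am; apply/bigmax_leqP => g _; apply/word_length_leP. Qed.

Lemma word_length_pred A (genA : generates A) g m :
  word_length genA g = m.+1 -> exists h, word_length genA h = m.
Proof.
move=> lg; have: within A m.+1 g by apply/(word_length_leP genA); rewrite lg.
case=> [[|x w] /= [szw Aw def_g]].
  have: (word_length genA g <= 0)%N.
    by apply/word_length_leP; rewrite -def_g big_nil; apply: within_id.
  by rewrite lg.
have{Aw} /andP[Ax Aw] := Aw.
exists (\prod_(y <- w) y); apply/eqP; rewrite eqn_leq; apply/andP; split.
  by apply/word_length_leP; exists w.
rewrite -ltnS -lg -add1n; apply/word_length_leP.
rewrite -def_g big_cons; apply: withinM; first exact: within_mem.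
by apply/word_length_leP; exact: leqnn.
Qed.

(** Starting from an element of maximal length, dropping the first letter of a shortest word lowers
    the length by exactly one. *)
Lemma word_length_onto A (genA : generates A) (i : 'I_(diam genA).+1) :
  exists g, word_length genA g = i.
Proof.
have [g lg]: exists g, word_length genA g = diam genA.
  rewrite /diam; have [|g ->] := @eq_bigmax gT (word_length genA); last by exists g.
  by apply/card_gt0P; exists 1.
suff H m j h : word_length genA h = (m + j)%N ->
    exists g', word_length genA g' = j.
  by apply: (H (diam genA - i)%N i g); rewrite lg subnK // -ltnS ltn_ord.
elim: m h => [|m IHm] h; first by exists h.
by rewrite addSn => /word_length_pred[h' /IHm].
Qed.

Lemma minimal_gen_not1 A :
  generates A -> #|A| = group_rank gT -> 1 \notin A.
Proof.
move=> /eqP genA cardA; apply/negP=> A1.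
have := grank_min (A :\ 1); rewrite genD1id genA -/(group_rank gT).
by rewrite -cardA (cardsD1 1 A) A1 ltnn.
Qed.

(** Pick one element of each length from 0 to the diameter, except length 1. These [diam genA]
    elements lie outside [A], all of whose elements have length 1. *)
Lemma diam_minimal_gen A (genA : generates A) :
  #|A| = group_rank gT -> (diam genA <= #|gT| - #|A|)%N.
Proof.
move=> cardA; have not1A := minimal_gen_not1 genA cardA.
have [-> // | d_gt0] := posnP (diam genA).
have [p lp] := fin_all_exists (@word_length_onto A genA).
have inj_p : injective p.
  by move=> i j eq_p; apply: val_inj; rewrite /= -(lp i) -(lp j) eq_p.
have one_lt : (1 < (diam genA).+1)%N by [].
pose S := p @: [set~ Ordinal one_lt].
have cardS: #|S| = diam genA by rewrite card_imset // cardsC1 card_ord.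
have disjAS: [disjoint A & S].
  rewrite -setI_eq0; apply/eqP/setP=> x; rewrite !inE; apply/negP.
  case/andP=> Ax /imsetP[i]; rewrite !inE => i_neq1 def_x.
  have: (word_length genA x <= 1)%N by apply/word_length_leP/within_mem.
  rewrite def_x lp leq_eqVlt ltnS leqn0 => /orP[i1 | i0].
    by case/negP: i_neq1; apply/eqP/val_inj/eqP.
  have: (word_length genA x <= 0)%N by rewrite def_x lp (eqP i0).
  by move/word_length_leP/within0=> x1; rewrite x1 (negPf not1A) in Ax.
rewrite leq_subRL; last exact: max_card.
have /eqP <- : #|A :|: S| == (#|A| + diam genA)%N.
  by rewrite -cardS (leq_card_setU A S).2.
exact: max_card.
Qed.

End Within.

(** * Morphisms, direct powers and ranks *)

Lemma within_morph (aT rT : finGroupType) (f : {morphism [set: aT] >-> rT})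
    (A : {set aT}) (B : {set rT}) m C g :
  (forall x, x \in A -> within B C (f x)) -> within A m g ->
  within B (m * C) (f g).
Proof.
move=> fA [w [szw Aw <-]].
apply: (within_leq (m := size w * C)); first by rewrite leq_mul2r szw orbT.
elim: w {szw} Aw => [|x w IHw] /=.
  by rewrite big_nil morph1 => _; apply: within_id.
case/andP=> Ax Aw; rewrite big_cons morphM ?inE // mulSn.
by apply: withinM; [apply: fA | apply: IHw].
Qed.

Lemma group_rank_surj (aT rT : finGroupType)
    (f : {morphism [set: aT] >-> rT}) :
  (forall y, exists x, f x = y) -> (group_rank rT <= group_rank aT)%N.
Proof.
move=> f_onto; have := morphim_grank f (subxx [set: aT]).
suff -> : f @* [set: aT] = [set: rT] by [].
apply/setP=> y; rewrite inE; have [x <-] := f_onto y.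
by rewrite mem_morphim ?inE.
Qed.

Lemma group_rank_direct_power (gT : finGroupType) k :
  (0 < k)%N -> (group_rank gT <= group_rank (direct_power gT k))%N.
Proof.
move=> k_gt0; pose i0 := Ordinal k_gt0.
apply: (group_rank_surj (f := @dffun_morphism 'I_k (fun=> gT) i0)) => y.
by exists [ffun=> y]; rewrite /= ffunE.
Qed.

Lemma direct_power_prod (gT : finGroupType) k (x : direct_power gT k) :
  x = \prod_(i < k) @dfung1 'I_k (fun=> gT) i (x i).
Proof.
apply/ffunP=> j; rewrite prodg_ffun (big_only1 j) ?dfung1_id //.
by move=> i i_neq_j _; rewrite dfung1_dflt.
Qed.

(** With exclusive or as product, [bool] is C_2; its power is elementary abelian of order 2^k, so
    the rank is the logarithm of the order. *)
Lemma group_rank_bool_power k : group_rank (direct_power bool k) = k.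
Proof.
have expB (x : direct_power bool k) : x ^+ 2 = 1.
  by apply/ffunP=> i; rewrite !ffunE; case: (x i).
have elemB : 2.-abelem [set: direct_power bool k].
  rewrite abelemE //; apply/andP; split; last first.
    by apply/exponentP=> x _; apply: expB.
  apply/centsP=> x _ y _; apply/ffunP=> i; rewrite !ffunE; exact: addbC.
rewrite /group_rank grank_abelian ?(abelem_abelian elemB) //.
rewrite (rank_abelem elemB) cardsT card_ffun card_bool card_ord.
by rewrite lognX logn_prime // muln1.
Qed.

Section SignPower.

Variables (T : finType) (k : nat).
Let P := direct_power {perm T} k.

Definition sign_power (x : P) : direct_power bool k :=
  [ffun i => odd_perm (x i)].

Lemma sign_powerM : {in [set: P] &, {morph sign_power : x y / x * y}}.
Proof.
by move=> x y _ _; apply/ffunP=> i; rewrite !ffunE odd_permM.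
Qed.

Canonical sign_power_morphism := Morphism sign_powerM.

Lemma group_rank_perm_power :
  (1 < #|T|)%N -> (k <= group_rank P)%N.
Proof.
case/card_gt1P=> a [b [_ _ neq_ab]]; rewrite -{1}(group_rank_bool_power k).
apply: (group_rank_surj (f := sign_power_morphism)) => y.
exists [ffun i => if y i then tperm a b else 1]; apply/ffunP=> i.
by rewrite !ffunE; case: (y i); rewrite ?odd_tperm ?neq_ab ?odd_perm1.
Qed.

End SignPower.

(** * Treating the coordinates separately by coprime orders *)

Section CoprimeOrders.

Variables (gT : finGroupType) (k m D : nat) (s c : gT).
Hypotheses (k_gt1 : (1 < k)%N) (odd_m : odd m).
Hypotheses (s2 : s ^+ 2 = 1) (cm : c ^+ m = 1).

Definition power_gen (i : 'I_k) : direct_power gT k :=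
  [ffun j => if j == i then s else if j == ordS i then c else 1].

Let A := [set power_gen i | i : 'I_k].

Lemma ordS_neq (i : 'I_k) : ordS i != i.
Proof.
apply/eqP=> /(congr1 val) /=; case: i => i lt_ik /=.
have [lt_i1k|] := ltnP i.+1 k; first by rewrite modn_small //; lia.
by move=> le_k; have -> : i.+1 = k by [lia]; rewrite modnn; lia.
Qed.

Lemma expg_ffun (x : direct_power gT k) l i : (x ^+ l) i = x i ^+ l.
Proof. exact: (morphX (@dffun_morphism _ (fun=> gT) i) l (in_setT x)). Qed.

Lemma power_gen_s (i : 'I_k) : power_gen i ^+ m = @dfung1 _ (fun=> gT) i s.
Proof.
apply/ffunP=> j; rewrite expg_ffun ffunE; case: eqVneq => [-> | neq_ji].
  rewrite dfung1_id -(odd_double_half m) odd_m -muln2 mulnC.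
  by rewrite expgD expgM s2 expg1n mulg1.
rewrite dfung1_dflt 1?eq_sym //; case: ifP => _; [exact: cm | exact: expg1n].
Qed.

Lemma power_gen_c (i : 'I_k) :
  power_gen i ^+ m.+1 = @dfung1 _ (fun=> gT) (ordS i) c.
Proof.
apply/ffunP=> j; rewrite expg_ffun ffunE; case: eqVneq => [-> | neq_ji].
  rewrite dfung1_dflt ?ordS_neq // -(odd_double_half m.+1) /= odd_m add0n.
  by rewrite -muln2 mulnC expgM s2 expg1n.
case: eqVneq => [-> | neq_jSi]; first by rewrite dfung1_id expgS cm mulg1.
by rewrite dfung1_dflt 1?eq_sym // expg1n.
Qed.

(** Each of the [k] coordinates is a word of at most [D] letters [s] or [c], and each such letter,
    placed in one coordinate, is a power of a single generator with exponent [m] or [m.+1]. *)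
Lemma within_power :
  (forall g, within [set s; c] D g) -> forall x, within A (k * (D * m.+1)) x.
Proof.
move=> scD x; rewrite (direct_power_prod x).
rewrite -[X in (X * _)%N](size_enum_ord k) enumT; apply: within_prod => i.
have A_pow j l : (l <= m.+1)%N -> within A m.+1 (power_gen j ^+ l).
  move=> le_l; apply: (within_leq (m := (l * 1)%N)); first by rewrite muln1.
  by apply/withinX/within_mem/imset_f.
apply: (within_morph (f := @dfung1_morphism _ (fun=> gT) i)) (scD (x i)) => y.
rewrite !inE => /orP[] /eqP->; first by rewrite /= -power_gen_s; apply: A_pow.
(* The letter [c] at coordinate [i] comes from the generator indexed by the cyclic predecessor of
   [i]. *)
by rewrite -(ord_predK i) /= -power_gen_c; apply: A_pow.
Qed.

End CoprimeOrders.

Lemma weak_conjecture_of_coprime (gT : finGroupType) (m D : nat) (s c : gT) :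
    odd m -> s ^+ 2 = 1 -> c ^+ m = 1 ->
    (forall g, within [set s; c] D g) ->
    (forall k, k <= group_rank (direct_power gT k))%N ->
    (D * m.+1 <= #|gT| - 2)%N ->
  weak_conjecture gT.
Proof.
move=> odd_m s2 cm scD rank_ge leD k k_gt0.
have [k_gt1 | k_le1] := ltnP 1 k.
  have Ak := within_power k_gt1 odd_m s2 cm scD.
  set A := imset _ _ in Ak; have genA := generates_within Ak.
  exists A, genA; split.
    (* The cardinality is squeezed: it is at most [k], hence at most the rank, and [A] generates. *)
    apply/eqP; rewrite eqn_leq; apply/andP; split.
      apply: leq_trans (rank_ge k).
      by apply: leq_trans (leq_imset_card _ _) _; rewrite card_ord.
    by rewrite /group_rank -(eqP genA) grank_min.
  apply: leq_trans (diam_leP genA Ak) _; rewrite leq_mul2l; apply/orP; right.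
  (* The set [[set s; c]] generates, so the rank of the base group is at most 2. *)
  apply: leq_trans leD _; apply: leq_sub2l.
  rewrite /group_rank -(eqP (generates_within scD)).
  by apply: leq_trans (grank_min _) _; rewrite cards2; case: (_ != _).
have {k_gt0 k_le1} -> : k = 1%N by apply/eqP; rewrite eqn_leq k_le1.
have [A /eqP genA cardA] := grank_witness [set: direct_power gT 1].
exists A, genA; split=> //; rewrite mul1n.
apply: leq_trans (diam_minimal_gen genA cardA) _.
have -> : #|A| = group_rank (direct_power gT 1) by [].
have := group_rank_direct_power gT (ltn0Sn 0).
by rewrite card_ffun card_ord expn1; apply: leq_sub2l.
Qed.

(** * Permutations as products of transpositions *)

Section PermWords.

Variables (T : finType) (A : {set {perm T}}) (L : nat).

(* Composing p with the transposition of x and p x, for a moved point x,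
   fixes x and creates no new moved point. *)
Lemma within_perm :
  (forall x y, within A L (tperm x y)) -> forall p, within A (#|T| * L) p.
Proof.
move=> AL p; apply: (within_leq (m := #|[set x | p x != x]| * L)).
  by rewrite leq_mul2r max_card orbT.
move: {2}_.+1 (ltnSn #|[set x | p x != x]|) => l.
elim: l p => // l IHl p; rewrite ltnS => le_pl.
have [p0 | [x]] := set_0Vmem [set x | p x != x].
  have -> : p = 1.
    apply/permP=> x; rewrite perm1; apply/eqP/negPn/negP=> px.
    by have := in_set0 x; rewrite -p0 inE px.
  exact: within_id.
rewrite inE => px; pose q := p * tperm x (p x).
have def_p : p = q * tperm x (p x) by rewrite /q -mulgA tperm2 mulg1.
have ltqp : (#|[set y | q y != y]| < #|[set y | p y != y]|)%N.
  apply: proper_card; apply/properP; split; last first.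
    by exists x; rewrite !inE // /q permM tpermR eqxx.
  apply/subsetP=> y; rewrite !inE; apply: contraNneq => py.
  have [-> | neq_yx] := eqVneq y x; first by rewrite /q permM tpermR.
  rewrite /q permM py tpermD // eq_sym //.
  by apply: contraNneq px => def_y; rewrite -(inj_eq (@perm_inj _ p)) -def_y py.
apply: (within_leq (m := #|[set y | q y != y]| * L + L)).
  by rewrite addnC -mulSn leq_mul2r; apply/orP; right.
by rewrite def_p; apply: withinM (AL _ _); apply: IHl; apply: leq_trans le_pl.
Qed.

(** For distinct [x], [y] other than [x0], conjugating (x0 y) by (x0 x) gives (x y), a product of
    three transpositions moving [x0]. *)
Lemma within_perm_star x0 :
  (forall y, within A L (tperm x0 y)) ->
  forall x y, within A (3 * L) (tperm x y).
Proof.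
move=> star x y.
have [-> | neq_xy] := eqVneq x y; first by rewrite tperm1; apply: within_id.
have [-> | neq_x0] := eqVneq x x0.
  by apply: within_leq (star y); rewrite leq_pmull.
have [-> | neq_y0] := eqVneq y x0.
  by rewrite tpermC; apply: within_leq (star x); rewrite leq_pmull.
have -> : tperm x y = tperm x0 x * (tperm x0 y * tperm x0 x).
  by rewrite -{1}(tpermV x0 x) -conjgE tpermJ tpermL tpermD // eq_sym.
apply: (within_leq (m := L + (L + L))); first by lia.
by do 2!apply: withinM => //.
Qed.

End PermWords.

(** * Transpositions as words in a transposition and a cycle *)

Section Rotation.

Variable M : nat.
Notation m := M.+2.

Definition rotation : {perm 'I_m} := perm (@ordS_inj m).

Lemma rotationX_val i (x : 'I_m) : (rotation ^+ i) x = (x + i) %% m :> nat.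
Proof.
elim: i => [|i IHi]; first by rewrite perm1 addn0 modn_small.
by rewrite expgSr permM permE /= IHi -addn1 modnDml -addnA addn1.
Qed.

Lemma rotation_order : rotation ^+ m = 1.
Proof.
apply/permP=> x; apply: val_inj.
by rewrite /= rotationX_val perm1 modnDr modn_small.
Qed.

Lemma rotationX0 (x : 'I_m) : (rotation ^+ x) ord0 = x.
Proof. by apply: val_inj; rewrite /= rotationX_val add0n modn_small. Qed.

Let s := tperm ord0 (ordS ord0 : 'I_m).
Let A := [set s; rotation].

Lemma within_adjacent (x : 'I_m) : within A m.+1 (tperm x (rotation x)).
Proof.
have -> : tperm x (rotation x) = s ^ (rotation ^+ x).
  rewrite tpermJ rotationX0 -[in RHS](permE (@ordS_inj m)) -!permM.
  by rewrite -/rotation -expgS expgSr permM rotationX0.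
apply: within_conjX; rewrite ?inE ?eqxx ?orbT //; first exact: rotation_order.
exact/ltnW/ltn_ord.
Qed.

(** Conjugation by an adjacent transposition moves the far end of the arc one step on, so each step
    adds two adjacent transpositions to the initial one. *)
Lemma within_arc (x : 'I_m) d :
  within A (d.*2.+1 * m.+1) (tperm x ((rotation ^+ d.+1) x)).
Proof.
elim: d => [|d IHd]; first by rewrite mul1n; apply: within_adjacent.
rewrite expgSr permM; set y := (rotation ^+ d.+1) x in IHd *.
(* As [d] is unbounded, the arc may wrap around: its old or new end can be [x] itself, and the
   conjugation formula then fails. *)
have [<- | neq_xy] := eqVneq x y.
  by apply: within_leq (within_adjacent x); rewrite leq_pmull.
have [<- | neq_xz] := eqVneq x (rotation y).
  by rewrite tperm1; apply: within_id.
have -> : tperm x (rotation y) =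
    tperm y (rotation y) * (tperm x y * tperm y (rotation y)).
  by rewrite -{1}(tpermV y (rotation y)) -conjgE tpermJ tpermL tpermD // eq_sym.
apply: (within_leq (m := m.+1 + (d.*2.+1 * m.+1 + m.+1))); first by lia.
by apply: withinM; [|apply: withinM => //]; apply: within_adjacent.
Qed.

Lemma within_rotation_tperm (x y : 'I_m) :
  within A ((m.-1).*2.-1 * m.+1) (tperm x y).
Proof.
have [-> | neq_xy] := eqVneq x y; first by rewrite tperm1; apply: within_id.
(* The number of rotation steps from [x] to [y]; adding [m] first keeps the subtraction from
   truncating. *)
pose d := (y + m - x) %% m.
have def_y : y = (rotation ^+ d) x.
  apply: val_inj; rewrite /= rotationX_val modnDmr subnKC.
    by rewrite modnDr modn_small.
  by apply: leq_trans (ltnW (ltn_ord x)) _; rewrite leq_addl.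
have lt_dm : (d < m)%N by rewrite ltn_pmod.
case: d => [|d] in def_y lt_dm *.
  by rewrite def_y perm1 eqxx in neq_xy.
rewrite def_y; apply: within_leq (within_arc x d).
(* The distance is now [d.+1], at most m - 1, whence 2d + 1 <= 2(m - 1) - 1. *)
by rewrite leq_mul2r; apply/orP; right; lia.
Qed.

(** The variant for even degree m + 1: [ord0] is fixed by [c'], which rotates the [m] lifted
    points. *)
Let s' := tperm ord0 (lift ord0 ord0 : 'I_m.+1).
Let c' := lift_perm ord0 ord0 rotation.

Lemma lift_rotationX i : c' ^+ i = lift_perm ord0 ord0 (rotation ^+ i).
Proof.
elim: i => [|i IHi]; first by rewrite lift_perm1.
by rewrite !expgS IHi lift_permM.
Qed.

Lemma within_lift_star y :
  within [set s'; c'] m.+1 (tperm ord0 y).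
Proof.
have [y' -> | ->] := unliftP ord0 y; last by rewrite tperm1; apply: within_id.
have -> : tperm ord0 (lift ord0 y') = s' ^ (c' ^+ y').
  rewrite tpermJ lift_rotationX lift_perm_id.
  by congr (tperm _ _); rewrite lift_perm_lift rotationX0.
apply: within_conjX; rewrite ?inE ?eqxx ?orbT //; last exact/ltnW/ltn_ord.
by rewrite lift_rotationX rotation_order lift_perm1.
Qed.

End Rotation.

(** * Numerical bounds and conclusion *)

(** The factors count, for a cycle of length [n]: transpositions per permutation, adjacent
    transpositions in each, letters in each of those, and generators of the power per letter. *)
Lemma fact_ge_odd_bound n : (7 <= n)%N ->
  (n * ((n.-1).*2.-1 * n.+1) * n.+1 + 2 <= n`!)%N.
Proof.
move=> n_ge7; rewrite -(subnKC n_ge7); elim: (n - 7)%N => [|i IHi] //.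
rewrite addnS factS; apply: leq_trans (leq_mul (leqnn (7 + i).+1) IHi).
have -> : ((7 + i).+1.-1.*2.-1 = 13 + 2 * i)%N by lia.
have -> : ((7 + i).-1.*2.-1 = 11 + 2 * i)%N by lia.
nia.
Qed.

(** Here the cycle has length n - 1, so a transposition moving the fixed point takes [n] letters, an
    arbitrary one [3 * n], and each letter costs [n] generators. *)
Lemma fact_ge_even_bound n : (7 <= n)%N ->
  (n * (3 * n) * n + 2 <= n`!)%N.
Proof.
move=> n_ge7; apply: leq_trans (fact_ge_odd_bound n_ge7).
rewrite leq_add2r leq_mul // leq_mul2l leq_mul ?orbT //; lia.
Qed.

Theorem corollary5p8 (n : nat) (hn : 7 <= n) : weak_conjecture {perm 'I_n}.
Proof.
have rank_ge k : (k <= group_rank (direct_power {perm 'I_n} k))%N.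
  by apply: group_rank_perm_power; rewrite card_ord; lia.
have card_perm : #|{perm 'I_n}| = n`! by exact: card_Sn.
have := fact_ge_odd_bound hn; have := fact_ge_even_bound hn.
(* Writing n as [M.+3] lets both cycle lengths, n and n - 1, have the form required by [rotation],
   with parameters [M.+1] and [M]. *)
case: n hn rank_ge card_perm => [|[|[|M]]] // hn rank_ge card_perm evenD oddD.
have [odd_n | even_n] := boolP (odd M.+3).
  have wD := within_perm (@within_rotation_tperm M.+1).
  apply: (weak_conjecture_of_coprime odd_n _ _ wD rank_ge).
  - by rewrite expgS expg1 tperm2.
  - exact: rotation_order.
  - by rewrite card_perm card_ord; lia.
have wD := within_perm (within_perm_star (@within_lift_star M)).
apply: (weak_conjecture_of_coprime (m := M.+2) _ _ _ wD rank_ge).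
- by move: even_n; rewrite /= !negbK.
- by rewrite expgS expg1 tperm2.
- by rewrite lift_rotationX rotation_order lift_perm1.
- by rewrite card_perm card_ord; lia.
Qed.
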